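(* Let $F\in\mathcal{F}_n$. For a $213$-avoiding full rook placement $R$ on $F$, let $F_R$ be the smallest Ferrers board containing all squares of $R$, and set $\delta_{213}(R)=(D_{F_R},D_F)$. Then $\delta_{213}$ is a bijection from the set $\mathcal{R}_F(213)$ of $213$-avoiding full rook placements on $F$ onto $\mathcal{D}^2_F$. Consequently there is a bijection $\mathcal{M}_F(213)\to\mathcal{D}^2_F$.
   Context: A Dyck path of semilength $n$ is a lattice path from $(0,n)$ to $(n,0)$ with unit east and south steps never going strictly below $y=n-x$; $\mathcal{D}_n$ is their set. $\mathcal{F}_n$ is the set of Ferrers boards (left-justified arrays of unit squares bounded by the coordinate axes and a path, rows weakly shorter going up) whose border $D_F$ is such a Dyck path. $\mathcal{D}^2_F$ is the set of pairs $(D_0,D_F)$, $D_0\in\mathcal{D}_n$, with $D_0$ never strictly above $D_F$. A full rook placement $R$ on $F$ has exactly one square in each row and column of $F$; $\Gamma(V)$ for a border vertex $V=(a,b)$ is the set of unit squares in $[0,a]\times[0,b]$; a set of squares with at most one per row and column determines a permutation by standardizing. $R$ avoids $\tau$ if for every border vertex $V$ the permutation determined by $R\cap\Gamma(V)$ avoids $\tau$. Matchings: $\mathcal{M}_F(\tau)$ is the set of perfect matchings $M$ of $[2n]$ whose shape is $F$ (border read from $1$ to $2n$: east step for each opener, south for each closer) avoiding $\tau\in S_k$, i.e. with no $i_1<\dots<i_{2k}$ such that all pairs $(i_a,i_{2k+1-\tau(a)})$ lie in $M$. *)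

(* Defs.v *)
From mathcomp Require Import all_boot all_fingroup.
From mathcomp Require Import classical_sets functions.

Set Implicit Arguments.
Unset Strict Implicit.
Unset Printing Implicit Defensive.

(* All indices are 0-based: the square (c, r) is [c, c+1] x [r, r+1], in column
   c counted from the left and row r counted from the bottom.  The border of a
   board of F_n joins (0, n) to (n, 0), so such a board lies in the n x n box. *)

Notation board n := {set 'I_n * 'I_n}.

Definition row_length n (F : board n) (r : nat) : nat :=
  #|[set s in F | s.2 == r :> nat]|.

Definition ferrers n (F : board n) : bool :=
  [forall c : 'I_n, forall c' : 'I_n, forall r : 'I_n,
     (c' <= c) && ((c, r) \in F) ==> ((c', r) \in F)] &&
  [forall r : 'I_n, forall r' : 'I_n,
     (r <= r') ==> (row_length F r' <= row_length F r)].

Definition east := true.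
Definition south := false.
Notation lpath := (seq bool).

Definition vertex n (D : lpath) (t : nat) : nat * nat :=
  (count_mem east (take t D), n - count_mem south (take t D)).

Definition vertices n (D : lpath) : seq (nat * nat) :=
  [seq vertex n D t | t <- iota 0 (size D).+1].

Definition dyck n (D : lpath) : bool :=
  [&& count_mem east D == n, count_mem south D == n &
      all (fun V => n - V.1 <= V.2) (vertices n D)].

(* Read from (0, n): on reaching height r.+1 the path is at abscissa
   row_length F r.+1; it goes east to abscissa row_length F r, then south along
   the right side of row r.  The last east steps run along the x-axis (there are
   none when the path is a Dyck path). *)
Definition border n (F : board n) : lpath :=
  flatten [seq rcons (nseq (row_length F r - row_length F r.+1) east) south
          | r <- rev (iota 0 n)]
  ++ nseq (n - row_length F 0) east.

Definition ferrers_dyck n (F : board n) : bool :=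
  ferrers F && dyck n (border F).

Definition strictly_above n (V : nat * nat) (D : lpath) : bool :=
  all (fun V' => (V'.1 == V.1) ==> (V'.2 < V.2)) (vertices n D).

Definition never_above n (D0 D1 : lpath) : bool :=
  ~~ has (fun V => strictly_above n V D1) (vertices n D0).

Definition dyck_pairs n (F : board n) : set (lpath * lpath) :=
  [set p | [/\ dyck n p.1, p.2 = border F & never_above n p.1 p.2]]%classic.

Definition full_rook_placement n (F R : board n) : Prop :=
  [/\ R \subset F,
      forall c : 'I_n, #|[set s in R | s.1 == c]| = 1 &
      forall r : 'I_n, #|[set s in R | s.2 == r]| = 1].

Definition Gamma n (V : nat * nat) : board n :=
  [set s : 'I_n * 'I_n | (s.1 < V.1) && (s.2 < V.2)].

(* Order-isomorphic word on 0, 1, ..., size w - 1, for w without repetition. *)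
Definition standardize (w : seq nat) : seq nat :=
  [seq count (fun y => y < x) w | x <- w].

(* One-line notation of the permutation determined by a set of squares. *)
Definition perm_of n (S : board n) : seq nat :=
  standardize
    [seq val s.2 | s <- sort (fun s t : 'I_n * 'I_n => s.1 <= t.1) (enum S)].

Definition one_line k (tau : 'S_k) : seq nat :=
  [seq val (tau i) | i <- enum 'I_k].

Definition word_avoids k (tau : 'S_k) (w : seq nat) : Prop :=
  forall u, subseq u w -> standardize u <> one_line tau.

Definition rook_avoids n k (F : board n) (tau : 'S_k) (R : board n) : Prop :=
  forall V, V \in vertices n (border F) ->
    word_avoids tau (perm_of (R :&: Gamma n V)).

Definition avoiding_rooks n k (F : board n) (tau : 'S_k) : set (board n) :=
  [set R | full_rook_placement F R /\ rook_avoids F tau R]%classic.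

Definition smallest_ferrers n (R : board n) : board n :=
  \bigcap_(B : board n | ferrers B && (R \subset B)) B.

Lemma ferrersP n (F : board n) :
  reflect (forall c c' r r' : 'I_n,
             c' <= c -> r' <= r -> (c, r) \in F -> (c', r') \in F)
          (ferrers F).
Proof.
apply: (iffP andP) => [[/forallP H1 /forallP H2] c c' r r' lec ler cF | H].
  have left (a b d : 'I_n) : b <= a -> (a, d) \in F -> (b, d) \in F.
    move=> leab aF; have /forallP/(_ b)/forallP/(_ d)/implyP := H1 a.
    by apply; rewrite leab.
  apply: (left c) => //; apply: contraT => ncF.
  have /forallP/(_ r)/implyP/(_ ler) := H2 r'.
  suff: row_length F r' < row_length F r by rewrite ltnNge => /negbTE->.
  pose g (s : 'I_n * 'I_n) := (s.1, r).
  rewrite /row_length -(@card_in_imset _ _ g); last first.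
    move=> [a1 b1] [a2 b2]; rewrite !inE /=.
    by move=> /andP[_ /eqP/val_inj->] /andP[_ /eqP/val_inj->] [->].
  apply: proper_card; apply/fintype.properP; split.
    apply/fintype.subsetP => x /imsetP[[a b]]; rewrite inE /= => /andP[aF /eqP/val_inj eb].
    move=> ->; rewrite !inE eqxx andbT /=; apply: (left c) => //.
    rewrite leqNgt; apply: contra ncF => ltca; apply: (left a); last by rewrite -eb.
    exact: ltnW.
  exists (c, r); first by rewrite !inE cF /=.
  apply/imsetP => -[[a b]]; rewrite inE /= => /andP[aF /eqP/val_inj eb] [eca].
  by move: ncF; rewrite eca -eb aF.
split.
  apply/forallP => c; apply/forallP => c'; apply/forallP => r.
  by apply/implyP => /andP[lec cF]; apply: (H c c' r r).
apply/forallP => r; apply/forallP => r'; apply/implyP => ler.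
pose g (s : 'I_n * 'I_n) := (s.1, r).
rewrite /row_length -(@card_in_imset _ _ g).
  apply/subset_leq_card/fintype.subsetP => x /imsetP[[a b]].
  rewrite inE /= => /andP[aF /eqP/val_inj eb] ->; rewrite inE eqxx andbT.
  by apply: (H a a b r) => //; rewrite eb.
move=> [a1 b1] [a2 b2]; rewrite !inE /=.
by move=> /andP[_ /eqP/val_inj->] /andP[_ /eqP/val_inj->] [->].
Qed.

Lemma smallest_ferrersP n (R : board n) :
  [/\ ferrers (smallest_ferrers R), R \subset smallest_ferrers R &
      forall B, ferrers B -> R \subset B -> smallest_ferrers R \subset B].
Proof.
split.
- apply/ferrersP => c c' r r' lec ler /bigcapP H; apply/bigcapP => B HB.
  have /andP[/ferrersP FB _] := HB.
  exact: (FB c c' r r' lec ler (H B HB)).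
- by apply/bigcapsP => B /andP[].
- by move=> B FB RB; apply: finset.bigcap_inf; rewrite FB.
Qed.

Definition delta n (F R : board n) : lpath * lpath :=
  (border (smallest_ferrers R), border F).

Notation edges n := {set {set 'I_(n + n)}}.

Definition perfect_matching n (M : edges n) : Prop :=
  finset.partition M [set: 'I_(n + n)] /\ forall B, B \in M -> #|B| = 2.

Definition opener n (M : edges n) (i : 'I_(n + n)) : bool :=
  [exists j : 'I_(n + n), (i < j) && ([set i; j] \in M)].

Definition matching_path n (M : edges n) : lpath :=
  [seq if opener M i then east else south | i <- enum 'I_(n + n)].

(* With 0-based indices, 2k+1-tau(a) becomes 2k-1-tau(a), i.e. rev_ord. *)
Definition matching_avoids n k (tau : 'S_k) (M : edges n) : Prop :=
  ~ exists2 i : 'I_(k + k) -> 'I_(n + n),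
      forall x y : 'I_(k + k), x < y -> i x < i y &
      forall a : 'I_k,
        [set i (lshift k a); i (rev_ord (lshift k (tau a)))] \in M.

Definition avoiding_matchings n k (F : board n) (tau : 'S_k) : set (edges n) :=
  [set M | [/\ perfect_matching M, matching_path M = border F &
               matching_avoids tau M]]%classic.

(* One-line notation 2 1 3. *)
Definition perm213 : 'S_3 := tperm (@Ordinal 3 0 isT) (@Ordinal 3 1 isT).

(* Main.v *)
(* Every square of a placement R lies in F, so the 3 of an occurrence of 213 in
   the permutation of R provides a corner of F containing this occurrence: R
   avoids 213 on F iff its permutation does.  Moreover R avoids 213 iff it is
   greedy in F_R, i.e. each rook, reading the columns from right to left, takes
   the highest free row of its column of F_R.  A board B has at most one greedy
   placement, whose smallest board is then B, and it has one as soon as it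
   contains the staircase, i.e. as soon as its border is a Dyck path.
   For matchings, the opener read as column c and the closer read as row r come
   in this order exactly when (c, r) is a square of F, so perfect matchings of
   shape F are full rook placements on F, and 213 has the same meaning in both. *)
Require Import Defs.
From mathcomp Require Import all_boot all_fingroup.
From mathcomp Require Import classical_sets functions.
From mathcomp Require Import zify.

Set Implicit Arguments.
Unset Strict Implicit.
Unset Printing Implicit Defensive.

(** * Lattice paths and boards *)

Definition steps (b : bool) (D : lpath) (t : nat) : nat := count_mem b (take t D).

Lemma leq_steps b D t t' : t <= t' -> steps b D t <= steps b D t'.
Proof.
move=> tt'; apply: leq_count_subseq.
by rewrite -(take_takel D tt'); apply: take_subseq.
Qed.

Lemma steps_size b D : steps b D (size D) = count_mem b D.
Proof. by rewrite /steps take_size. Qed.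

Lemma steps_le b D t : steps b D t <= count_mem b D.
Proof. exact: leq_count_subseq (take_subseq _ _). Qed.

Lemma stepsS b D t : t < size D ->
  steps b D t.+1 = steps b D t + (nth east D t == b).
Proof.
by move=> tD; rewrite /steps (take_nth east tD) -cats1 count_cat /= addn0.
Qed.

Lemma count_steps (D : lpath) : count_mem east D + count_mem south D = size D.
Proof. by elim: D => //= -[] D <-; rewrite /=; lia. Qed.

Lemma steps_sum D t : t <= size D -> steps east D t + steps south D t = t.
Proof. by move=> tD; rewrite /steps count_steps size_takel. Qed.

(** A counter growing by at most one per step takes every intermediate value. Here [u] is the index
    of the [b]-step number [a], counted from 0. *)
Lemma steps_ivt b D t a : t <= size D -> a < steps b D t ->
  exists u, [/\ u < t, nth east D u = b & steps b D u = a].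
Proof.
elim: t => [|t IH] tD; first by rewrite /steps take0.
rewrite (stepsS _ tD); case: (ltnP a (steps b D t)) => [lt_a _ | ge_a lt_a].
  by have [u [ut Du Su]] := IH (ltnW tD) lt_a; exists u; split=> //; apply: ltnW.
have Db : nth east D t == b by case: eqP lt_a => // _; lia.
by exists t; split=> //; [apply/eqP | move: lt_a; rewrite Db; lia].
Qed.

Lemma vertexE n D t : vertex n D t = (steps east D t, n - steps south D t).
Proof. by []. Qed.

Lemma verticesP n D V :
  reflect (exists2 t, t <= size D & V = (steps east D t, n - steps south D t))
          (V \in vertices n D).
Proof.
apply: (iffP mapP) => [[t] | [t tD ->]].
  by rewrite mem_iota /= add0n ltnS => tD ->; exists t.
by exists t; rewrite // mem_iota /= add0n ltnS.
Qed.

(** Paths from (0, n) to (n, 0) with no Dyck condition. The correspondence between paths and Ferrers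
    boards in the box is proved at this generality. *)
Definition balanced n (D : lpath) : bool :=
  (count_mem east D == n) && (count_mem south D == n).

Lemma balanced_size n D : balanced n D -> size D = n + n.
Proof. by rewrite -count_steps => /andP[/eqP-> /eqP->]. Qed.

Lemma balanced_steps n b D t : balanced n D -> steps b D t <= n.
Proof.
by case/andP=> /eqP bE /eqP bS; apply: leq_trans (steps_le _ _ _) _; case: b; rewrite ?bE ?bS.
Qed.

Lemma dyck_balanced n D : dyck n D -> balanced n D.
Proof. by case/and3P=> /eqP bE /eqP bS _; rewrite /balanced bE bS !eqxx. Qed.

Lemma dyckP n D :
  reflect (balanced n D /\
           forall t, t <= size D -> steps south D t <= steps east D t)
          (dyck n D).
Proof.
rewrite /dyck andbA -/(balanced n D).
apply: (iffP andP) => -[bD H]; split=> //.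
  move=> t tD; have /(allP H) : vertex n D t \in vertices n D.
    by apply/verticesP; exists t.
  by rewrite vertexE /=; have := balanced_steps south t bD; lia.
apply/allP => V /verticesP[t tD ->] /=; have := H t tD; lia.
Qed.

(** The union of the rectangles [Gamma n V] over the vertices of [D]; it will be the inverse of
    [border]. *)
Definition board_of n (D : lpath) : board n :=
  [set x : 'I_n * 'I_n | has (fun V => (x.1 < V.1) && (x.2 < V.2)) (vertices n D)].

Lemma board_ofP n D (x : 'I_n * 'I_n) :
  reflect (exists t, [/\ t <= size D, x.1 < steps east D t &
                         x.2 < n - steps south D t])
          (x \in board_of n D).
Proof.
rewrite inE; apply: (iffP hasP) => [[V /verticesP[t tD ->] /= /andP[]] | [t [tD h1 h2]]].
  by move=> h1 h2; exists t.
exists (steps east D t, n - steps south D t); first by apply/verticesP; exists t.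
by rewrite /= h1.
Qed.

Lemma ferrers_board_of n D : ferrers (board_of n D).
Proof.
apply/ferrersP => c c' r r' lec ler /board_ofP[t /= [tD h1 h2]].
by apply/board_ofP; exists t; split=> //=; lia.
Qed.

(** After [t] steps both paths are on the diagonal x - y = t - n, so comparing them vertically
    amounts to comparing their abscissas on each diagonal. *)
Lemma never_aboveP n D0 D1 : balanced n D0 -> balanced n D1 ->
  reflect (forall t, t <= n + n -> steps east D0 t <= steps east D1 t)
          (never_above n D0 D1).
Proof.
move=> b0 b1; have [s0 s1] := (balanced_size b0, balanced_size b1).
apply: (iffP hasPn) => [H t tn | H V /verticesP[t tD ->]].
  have /H/allPn[V1] : vertex n D0 t \in vertices n D0.
    by apply/verticesP; exists t; rewrite ?s0.
  move=> /verticesP[u]; rewrite s1 => un ->.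
  rewrite vertexE negb_imply /= => /andP[/eqP eE leS].
  have := steps_sum (D := D0) (t := t); have := steps_sum (D := D1) (t := u).
  rewrite s0 s1 => /(_ un) sum1 /(_ tn) sum0.
  have := balanced_steps south u b1; have := balanced_steps south t b0.
  by move=> h1 h2; rewrite -eE; apply: leq_steps; lia.
rewrite s0 in tD; have leE := H t tD.
(* [D1] reaches the abscissa of vertex [t] of [D0] at a time [u] no later than [t], hence after at
   most as many south steps. *)
have [u [un eu ut]] : exists u, [/\ u <= n + n, steps east D1 u = steps east D0 t & u <= t].
  move: leE; rewrite leq_eqVlt => /predU1P[eE|ltE]; first by exists t.
  have tD1 : t <= size D1 by rewrite s1.
  by have [u [ut _ eu]] := steps_ivt tD1 ltE; exists u; split=> //; lia.
apply/allPn; exists (steps east D1 u, n - steps south D1 u).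
  by apply/verticesP; exists u; rewrite ?s1.
rewrite /= eu eqxx /= -leqNgt; apply: leq_sub2l.
have := steps_sum (D := D0) (t := t); have := steps_sum (D := D1) (t := u).
rewrite s0 s1 => /(_ un) sum1 /(_ tD) sum0; lia.
Qed.

Lemma never_above_board n D0 D1 : balanced n D0 -> balanced n D1 ->
  never_above n D0 D1 = (board_of n D0 \subset board_of n D1).
Proof.
move=> b0 b1; have [s0 s1] := (balanced_size b0, balanced_size b1).
have sum0 t : t <= n + n -> steps east D0 t + steps south D0 t = t.
  by move=> tn; apply: steps_sum; rewrite s0.
have sum1 t : t <= n + n -> steps east D1 t + steps south D1 t = t.
  by move=> tn; apply: steps_sum; rewrite s1.
apply/(never_aboveP b0 b1)/fintype.subsetP => [H x /board_ofP[t [tD h1 h2]] | H t tn].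
  rewrite s0 in tD; apply/board_ofP; exists t; rewrite s1; split=> //.
    exact: leq_trans h1 (H t tD).
  by have := H t tD; have := sum0 t tD; have := sum1 t tD; lia.
have [//|lt10] := leqP.
have := (balanced_steps south t b0, balanced_steps south t b1, balanced_steps east t b0).
case=> -[le0 le1] le0'; have [e0 e1] := (sum0 t tn, sum1 t tn).
(* The square whose upper right corner is vertex [t] of [D0]. To cover it, a vertex of [D1] would
   have to come both after and before time [t]. *)
have ltc : (steps east D0 t).-1 < n by lia.
have ltr : (n - steps south D0 t).-1 < n by lia.
have /H/board_ofP[u /=] : (Ordinal ltc, Ordinal ltr) \in board_of n D0.
  by apply/board_ofP; exists t; rewrite s0; split=> //=; lia.
rewrite s1 => -[un h1 h2].
have [ut|tu] := leqP u t; first by have := leq_steps east D1 ut; lia.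
by have := leq_steps south D1 (ltnW tu); lia.
Qed.

Lemma eq_steps D0 D1 : size D0 = size D1 ->
  (forall t, t <= size D0 -> steps east D0 t = steps east D1 t) -> D0 = D1.
Proof.
move=> eqs H; apply: (eq_from_nth (x0 := east)) => // i iD.
have := H i.+1 iD; rewrite !stepsS -?eqs // (H i (ltnW iD)) => /addnI.
by case: (nth _ D0 i); case: (nth _ D1 i).
Qed.

Lemma board_of_inj n D0 D1 : balanced n D0 -> balanced n D1 ->
  board_of n D0 = board_of n D1 -> D0 = D1.
Proof.
move=> b0 b1 eB; have [s0 s1] := (balanced_size b0, balanced_size b1).
have : never_above n D0 D1 by rewrite never_above_board // eB.
have : never_above n D1 D0 by rewrite never_above_board // eB.
move=> /(never_aboveP b1 b0) H1 /(never_aboveP b0 b1) H0.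
apply: eq_steps; rewrite s0 ?s1 // => t tn.
by apply/eqP; rewrite eqn_leq H0 ?H1.
Qed.

(** * Row lengths and the border of a board *)

Lemma row_length_out n (F : board n) r : n <= r -> row_length F r = 0.
Proof.
move=> nr; apply/eqP; rewrite cards_eq0; apply/eqP/setP => x.
by rewrite !inE; apply/negbTE; rewrite negb_and; apply/orP; right; have := ltn_ord x.2; lia.
Qed.

Lemma card_ord_lt n m : m <= n -> #|[set c : 'I_n | c < m]| = m.
Proof.
move=> mn; rewrite -[RHS]card_ord -(card_imset _ (f := widen_ord mn)); last first.
  by move=> x y /(congr1 val) /= /val_inj.
apply: eq_card => x; rewrite inE; apply/idP/imsetP => [xm|[y _ ->]]; last exact: (ltn_ord y).
by exists (Ordinal xm) => //; apply: val_inj.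
Qed.

Lemma row_lengthP n (F : board n) (c r : 'I_n) : ferrers F ->
  (c < row_length F r) = ((c, r) \in F).
Proof.
move=> /ferrersP FF; pose f (s : 'I_n * 'I_n) := val s.1.
have eqc : row_length F r = #|[set c' | (c', r) \in F]|.
  rewrite /row_length -(card_imset [set c' | (c', r) \in F] (f := fun c' => (c', r)));
    last by move=> ? ? [].
  apply: eq_card => -[a b]; rewrite inE /=; apply/andP/imsetP => [[abF /eqP/val_inj br]|[a']].
    by exists a; rewrite ?inE -br.
  by rewrite inE => aF [-> ->].
rewrite eqc; apply/idP/idP => [lt|cF].
  apply: contraLR lt => ncF; rewrite -leqNgt -[leqRHS](card_ord_lt (ltnW (ltn_ord c))).
  apply/subset_leq_card/fintype.subsetP => a; rewrite !inE => aF.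
  by rewrite ltnNge; apply: contra ncF => ca; apply: (FF a c r r).
rewrite -[ltnLHS]/(c : nat) -[ltnRHS]/(#|_|) -(card_ord_lt (ltn_ord c)).
apply/subset_leq_card/fintype.subsetP => a; rewrite !inE => ac.
exact: (FF c a r r).
Qed.

Lemma row_lengthS n (F : board n) r : ferrers F ->
  row_length F r.+1 <= row_length F r.
Proof.
move=> /andP[_ /forallP H]; case: (ltnP r.+1 n) => rn; last by rewrite row_length_out.
by have /forallP/(_ (Ordinal rn))/implyP/(_ (leqnSn r)) := H (Ordinal (ltnW rn)).
Qed.

Lemma row_length_le n (F : board n) r : row_length F r <= n.
Proof.
rewrite /row_length -[leqRHS]card_ord.
rewrite -(card_in_imset (f := fst) (D := [set s in F | s.2 == r :> nat])).
  exact: max_card.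
move=> [a b] [a' b']; rewrite !inE /= => /andP[_ /eqP eb] /andP[_ /eqP eb'] ->.
by congr (_, _); apply: val_inj; rewrite /= eb.
Qed.

(** The initial part of [border F], down to height [r]; it allows an induction on the rows from the
    top. *)
Definition border_above n (F : board n) (r : nat) : lpath :=
  flatten [seq rcons (nseq (row_length F i - row_length F i.+1) east) south
          | i <- rev (iota r (n - r))].

Lemma border_aboveS n (F : board n) r : r < n ->
  border_above F r =
  border_above F r.+1 ++ rcons (nseq (row_length F r - row_length F r.+1) east) south.
Proof.
move=> rn; rewrite /border_above; have -> : n - r = (n - r.+1).+1 by lia.
by rewrite /= rev_cons map_rcons flatten_rcons.
Qed.

Lemma border_above_count n (F : board n) r : ferrers F -> r <= n ->
  count_mem east (border_above F r) = row_length F r /\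
  count_mem south (border_above F r) = n - r.
Proof.
move=> FF; move: {2}(n - r) (erefl (n - r)) => k; elim: k r => [|k IH] r ek rn.
  by rewrite /border_above ek /= row_length_out //; lia.
have rn' : r < n by lia.
have [|//|e1 e2] := IH r.+1; first by lia.
rewrite border_aboveS // !count_cat e1 e2 -cats1 !count_cat !count_nseq /=.
by have := row_lengthS r FF; lia.
Qed.

Lemma border_split n (F : board n) r : r <= n ->
  exists D, border F = border_above F r ++ D.
Proof.
move=> rn; rewrite /border; have -> : iota 0 n = iota 0 r ++ iota r (n - r).
  by rewrite -[X in iota X (n - r)]add0n -iotaD subnKC.
by rewrite rev_cat map_cat flatten_cat -catA; eexists.
Qed.

Lemma balanced_border n (F : board n) : ferrers F -> balanced n (border F).
Proof.
move=> FF; have -> : border F = border_above F 0 ++ nseq (n - row_length F 0) east.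
  by rewrite /border_above subn0.
have [e1 e2] := border_above_count FF (leq0n n); have := row_length_le F 0.
by rewrite /balanced !count_cat e1 e2 !count_nseq /=; lia.
Qed.

(** Up to the end of [border_above F r] the abscissa is at most [row_length F r]; later vertices
    have height at most [r], so they do not cover row [r]. *)
Lemma board_of_border n (F : board n) : ferrers F -> board_of n (border F) = F.
Proof.
move=> FF; apply/setP => -[c r]; rewrite -(row_lengthP c r FF).
have [rn [E S]] := (ltn_ord r, border_above_count FF (ltnW (ltn_ord r))).
have [E' S'] := border_above_count FF rn.
have [D eD] := border_split F (ltnW rn).
apply/board_ofP/idP => [[t [tD /= h1 h2]]|lt].
  apply: leq_trans h1 _; have [tle|tge] := leqP t (size (border_above F r)).
    rewrite -E -steps_size; apply: leq_trans (leq_steps _ _ tle) _.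
    by rewrite eD /steps take_size_cat // take_size.
  have := leq_steps south (border F) (ltnW tge).
  by rewrite {1}eD {1}/steps take_size_cat // S; lia.
(* The time at which the border is at the upper right corner of row [r], the point
   ([row_length F r], [r.+1]). *)
pose t := size (border_above F r.+1) + (row_length F r - row_length F r.+1).
have et : take t (border F) = border_above F r.+1 ++ nseq (row_length F r - row_length F r.+1) east.
  rewrite eD border_aboveS // -cats1 -!catA catA take_size_cat //.
  by rewrite size_cat size_nseq.
exists t; rewrite /steps et !count_cat E' S' !count_nseq /=; split.
- by rewrite -[leqRHS](size_takel (leqnn _)) take_size eD border_aboveS //;
     rewrite -cats1 !size_cat size_nseq /= /t; lia.
- by have := row_lengthS r FF; move: lt => /=; lia.
- by rewrite /=; lia.
Qed.

(** Both paths have the same board, so injectivity of [board_of] spares computing the row lengths of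
    [board_of n D]. *)
Lemma border_board_of n D : balanced n D -> border (board_of n D) = D.
Proof.
move=> bD; have FB := ferrers_board_of n D.
by apply: (board_of_inj (balanced_border FB) bD); apply: board_of_border.
Qed.

(** For a Dyck path, the vertex just after the east step over column [c] has height at least
    [n - c], so it covers the squares of the staircase in that column. Conversely, a vertex strictly
    below the antidiagonal is the lower left corner of a staircase square outside the board. *)
Lemma dyck_staircase n D : balanced n D ->
  dyck n D <-> forall x : 'I_n * 'I_n, x.1 + x.2 < n -> x \in board_of n D.
Proof.
move=> bD; have sD := balanced_size bD; split=> [/dyckP[_ dD] [c r] /= lt | H].
  have c_lt : c < steps east D (size D).
    by rewrite steps_size; case/andP: bD => /eqP->.
  have [t [tD Dt Et]] := steps_ivt (leqnn _) c_lt.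
  apply/board_ofP; exists t.+1; rewrite !stepsS // Dt Et /=; split=> //; first by lia.
  by have := dD t (ltnW tD); lia.
apply/dyckP; split=> // t tD; rewrite leqNgt; apply/negP => lt.
have := balanced_steps south t bD => leS.
have ltc : steps east D t < n by lia.
have ltr : n - steps south D t < n by lia.
have /H/board_ofP[u [uD /= h1 h2]] :
  (Ordinal ltc, Ordinal ltr).1 + (Ordinal ltc, Ordinal ltr).2 < n by rewrite /=; lia.
have [ut|tu] := leqP u t; first by have := leq_steps east D ut; lia.
by have := leq_steps south D (ltnW tu); lia.
Qed.

(** * Greedy placements *)

Definition rooks n (s : {perm 'I_n}) : board n := [set x : 'I_n * 'I_n | x.2 == s x.1].

Lemma full_rook_placementP n (F R : board n) :
  full_rook_placement F R <-> exists2 s, R = rooks s & R \subset F.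
Proof.
split=> [[RF Hc Hr] | [s -> sF]]; last first.
  split=> // [c|r]; apply/eqP/cards1P.
    by exists (c, s c); apply/setP => -[a b]; rewrite !inE /= xpair_eqE andbC; case: eqP => // ->.
  exists ((s^-1)%g r, r); apply/setP => -[a b]; rewrite !inE /= xpair_eqE.
  by rewrite -(inj_eq (@perm_inj _ s) a) permKV; case: (b =P r) => [->|]; rewrite ?andbF // eq_sym.
have ex c : exists r, (c, r) \in R.
  have /eqP/cards1P[[a b] e] := Hc c; have : (a, b) \in [set s in R | s.1 == c] by rewrite e inE.
  by rewrite inE /= => /andP[abR /eqP <-]; exists b.
have [s sR] := fin_all_exists ex.
have s_inj : injective s.
  move=> a b eab; have /eqP/cards1P[x e] := Hr (s a).
  have : (a, s a) \in [set t in R | t.2 == s a] by rewrite inE sR /=.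
  have : (b, s b) \in [set t in R | t.2 == s a] by rewrite inE sR /= eab.
  by rewrite e !inE => /eqP <- /eqP [].
exists (perm s_inj) => //; apply/setP => -[a b]; rewrite inE /= permE.
apply/idP/eqP => [abR|->//].
have /eqP/cards1P[x e] := Hc a.
have : (a, s a) \in [set t in R | t.1 == a] by rewrite inE sR /=.
have : (a, b) \in [set t in R | t.1 == a] by rewrite inE abR /=.
by rewrite e !inE => /eqP <- /eqP [].
Qed.

Definition no213 n (R : board n) : Prop :=
  forall x y z, x \in R -> y \in R -> z \in R ->
    x.1 < y.1 -> y.1 < z.1 -> y.2 < x.2 -> x.2 < z.2 -> False.

Lemma mem_smallest_ferrers n (R : board n) (x : 'I_n * 'I_n) :
  reflect (exists2 y, y \in R & (x.1 <= y.1) && (x.2 <= y.2))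
          (x \in smallest_ferrers R).
Proof.
have [/ferrersP FS RS minS] := smallest_ferrersP R.
apply: (iffP idP) => [xS | [[c' r'] yR /andP[le1 le2]]]; last first.
  case: x le1 le2 => c r /= le1 le2; apply: (FS c' c r' r) => //.
  exact: (fintype.subsetP RS).
(* The squares weakly south-west of a square of [R] form a Ferrers board containing [R], hence
   containing the smallest one. *)
pose B := [set x : 'I_n * 'I_n | [exists y in R, (x.1 <= y.1) && (x.2 <= y.2)]].
have inB z : z \in B -> exists2 y, y \in R & (z.1 <= y.1) && (z.2 <= y.2).
  by rewrite inE => /exists_inP.
apply: inB; apply: (fintype.subsetP (minS B _ _)) xS.
  apply/ferrersP => c c' r r' lec ler; rewrite !inE => /exists_inP[y yR /= /andP[h1 h2]].
  by apply/exists_inP; exists y; rewrite //= (leq_trans lec) // (leq_trans ler).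
apply/fintype.subsetP => y yR; rewrite inE; apply/exists_inP.
by exists y; rewrite ?leqnn.
Qed.

(* Reading the columns from right to left, each rook is on the highest row of
   its column of [B] that is still free. *)
Definition greedy n (B : board n) (s : {perm 'I_n}) : Prop :=
  rooks s \subset B /\
  forall c c' : 'I_n, c < c' -> s c' < s c -> (c', s c) \notin B.

Lemma mem_rooks n (s : {perm 'I_n}) c : (c, s c) \in rooks s.
Proof. by rewrite inE. Qed.

(** If ([c'], [s c]) were in the smallest board, some rook of column [a] would be weakly north-east
    of it. It differs from the rooks of [c] and [c'], so columns [c], [c'], [a] would form a 213. *)
Lemma no213_greedy n (s : {perm 'I_n}) :
  no213 (rooks s) -> greedy (smallest_ferrers (rooks s)) s.
Proof.
move=> H; split=> [|c c' ltc lts]; first by have [] := smallest_ferrersP (rooks s).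
apply/negP => /mem_smallest_ferrers[[a b]]; rewrite inE /= => /eqP-> /andP[h1 h2].
apply: (H (c, s c) (c', s c') (a, s a)); rewrite ?mem_rooks //=.
  by rewrite ltn_neqAle h1 andbT; apply/eqP => /val_inj e; move: h2; rewrite -e; lia.
by rewrite ltn_neqAle h2 andbT; apply/eqP => /val_inj/perm_inj e; move: h1; rewrite -e; lia.
Qed.

(** In a 213, the square in the column of the 1 and the row of the 2 is south-west of the 3, hence
    in [B]; greediness forbids this. *)
Lemma greedy_no213 n (B : board n) s : ferrers B -> greedy B s -> no213 (rooks s).
Proof.
move=> /ferrersP FB [/fintype.subsetP sB gs] [a a'] [b b'] [c c'].
rewrite !inE /= => /eqP-> /eqP-> /eqP-> ab bc ba ac.
have /negP := gs a b ab ba; apply; apply: (FB c b (s c)); try exact: ltnW.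
by apply: sB; rewrite mem_rooks.
Qed.

(** For a square ([c], [r]) of [B], either the rook of row [r] is in column [c] or to its right, or
    greediness puts the rook of column [c] at height at least [r]. In both cases a rook is weakly
    north-east of the square. *)
Lemma greedy_smallest n (B : board n) s : ferrers B -> greedy B s ->
  smallest_ferrers (rooks s) = B.
Proof.
move=> FB [sB gs]; apply/eqP; rewrite finset.eqEsubset; apply/andP; split.
  by have [_ _] := smallest_ferrersP (rooks s); apply.
apply/fintype.subsetP => -[c r] crB; apply/mem_smallest_ferrers => /=.
pose c1 := (s^-1)%g r; have sc1 : s c1 = r by rewrite permKV.
have [cc1|c1c] := leqP c c1; first by exists (c1, s c1); rewrite ?mem_rooks //= cc1 sc1 leqnn.
exists (c, s c); rewrite ?mem_rooks //= leqnn /= leqNgt; apply/negP => lt.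
have := gs c1 c c1c; rewrite sc1 => /(_ lt)/negP; exact.
Qed.

Lemma greedy_uniq n (B : board n) s s' : greedy B s -> greedy B s' -> s = s'.
Proof.
(* Induction on the columns from right to left, with [k = n - c]. The inequality [key] is used once
   in each direction. *)
suff key k (t t' : {perm 'I_n}) : greedy B t -> greedy B t' ->
    (forall c : 'I_n, n - c < k -> t c = t' c) ->
    forall c : 'I_n, n - c = k -> t' c <= t c.
  move=> gs gs'; apply/permP => c; move: {2}(n - c) (erefl (n - c)) => k.
  elim/ltn_ind: k c => k IH c ck; apply: val_inj; apply/eqP; rewrite eqn_leq.
  by rewrite !(key k) // => c1 c1k; [rewrite (IH _ c1k) | rewrite (IH _ c1k)].
move=> [_ gt] [/fintype.subsetP tB _] agree c ck; rewrite leqNgt; apply/negP => lt.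
(* The column in which [t] uses row [t' c]. It is not right of [c], where [t] and [t'] agree, nor
   [c] itself; being left of [c], it contradicts greediness of [t]. *)
pose c1 := (t^-1)%g (t' c); have tc1 : t c1 = t' c by rewrite permKV.
suff c1c : c1 < c.
  have := gt c1 c c1c; rewrite tc1 => /(_ lt)/negP; apply.
  by apply: tB; rewrite mem_rooks.
rewrite ltnNge; apply/negP; rewrite leq_eqVlt => /predU1P[/val_inj e|cc1].
  by move: lt; rewrite -tc1 e ltnn.
have : t c1 = t' c1 by apply: agree; have := ltn_ord c1; lia.
by rewrite tc1 => /perm_inj e; move: cc1; rewrite e ltnn.
Qed.

(* Exchanging the rooks of two columns violating greediness increases
   [\sum_c c * s c], so a maximizer of this sum is greedy. *)
Lemma greedy_exists n (B : board n) : ferrers B ->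
  (forall x : 'I_n * 'I_n, x.1 + x.2 < n -> x \in B) -> exists s, greedy B s.
Proof.
move=> /ferrersP FB stair.
(* The antidiagonal placement lies in the staircase, so there is something to maximize over. *)
pose s0 := perm (@rev_ord_inj n).
have s0B : rooks s0 \subset B.
  apply/fintype.subsetP => -[c r]; rewrite inE /= permE => /eqP ->.
  by apply: stair; have := ltn_ord c; rewrite /=; lia.
pose w (s : {perm 'I_n}) := \sum_(c < n) c * s c.
case: (@arg_maxnP _ s0 (fun s => rooks s \subset B) w s0B) => s sB max_s.
have /fintype.subsetP sB' := sB; exists s; split=> // c c' ltc lts; apply/negP => cB.
have neq : c != c' by apply/eqP => e; move: ltc; rewrite e ltnn.
have wE (t : {perm 'I_n}) : w t = c * t c + c' * t c' + \sum_(i | (i != c) && (i != c')) i * t i.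
  by rewrite /w (bigD1 c) // (bigD1 c') 1?eq_sym //= addnA.
pose t := (tperm c c' * s)%g.
have tc : t c = s c' by rewrite permM tpermL.
have tc' : t c' = s c by rewrite permM tpermR.
have tD i : i != c -> i != c' -> t i = s i.
  by move=> ic ic'; rewrite permM tpermD // eq_sym.
have /max_s : rooks t \subset B.
  apply/fintype.subsetP => -[i j]; rewrite inE /= => /eqP ->.
  have [->|ic] := eqVneq i c.
    by rewrite tc; apply: (FB c' c (s c)); [exact: ltnW | exact: ltnW | exact: cB].
  have [->|ic'] := eqVneq i c'; first by rewrite tc'.
  by rewrite tD //; apply: sB'; rewrite mem_rooks.
have eD : \sum_(i < n | (i != c) && (i != c')) i * t i =
          \sum_(i < n | (i != c) && (i != c')) i * s i.
  by apply: eq_bigr => i /andP[ic ic']; rewrite tD.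
(* What remains is the rearrangement inequality: for x < y and v < u, x * v + y * u exceeds x * u +
   y * v. *)
rewrite !wE tc tc' eD /= leq_add2r => {wE tc tc' eD tD}.
move: (nat_of_ord c) (nat_of_ord c') (nat_of_ord (s c)) (nat_of_ord (s c')) ltc lts.
by move=> x y u v; nia.
Qed.

(** Pigeonhole: were no rook weakly north-east of ([c], [r]), the [n - c] rooks of the columns from
    [c] on would all lie in the [r] lowest rows, against [c + r < n]. *)
Lemma rooks_staircase n (B : board n) s : ferrers B -> rooks s \subset B ->
  forall x : 'I_n * 'I_n, x.1 + x.2 < n -> x \in B.
Proof.
move=> /ferrersP FB /fintype.subsetP sB [c r] /= lt.
have [/existsP[a /andP[ca ra]]|/existsPn H] := boolP [exists a : 'I_n, (c <= a) && (r <= s a)].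
  by apply: (FB a c (s a)) => //; apply: sB; rewrite mem_rooks.
have := ltn_ord c; have := ltn_ord r => rn cn.
have : #|s @: [set a : 'I_n | c <= a]| <= #|[set b : 'I_n | b < r]|.
  apply/subset_leq_card/fintype.subsetP => b /imsetP[a]; rewrite inE => ca ->.
  by rewrite inE ltnNge; have := H a; rewrite ca.
rewrite card_imset; last exact: perm_inj.
have := cardsC [set a : 'I_n | a < c]; rewrite card_ord.
have -> : ~: [set a : 'I_n | a < c] = [set a : 'I_n | c <= a].
  by apply/setP => a; rewrite !inE -leqNgt.
rewrite !card_ord_lt ?(ltnW rn) ?(ltnW cn) // => h1.
by rewrite -(leq_add2l c) h1 leqNgt lt.
Qed.

(** The border determines the smallest board and then, by [greedy_uniq], the placement. The preimage
    of a path [D] is the greedy placement on [board_of n D]. *)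
Lemma delta_bij n (F : board n) : ferrers_dyck F ->
  set_bij [set R | full_rook_placement F R /\ no213 R]%classic (dyck_pairs F) (delta F).
Proof.
case/andP=> FF dF; have bF := dyck_balanced dF; split.
- move=> R /= [/full_rook_placementP[s -> sF] no].
  have [FS RS minS] := smallest_ferrersP (rooks s).
  have bS := balanced_border FS.
  split=> //=; last by rewrite never_above_board // !board_of_border // minS.
  by apply/dyck_staircase; rewrite ?board_of_border //; apply: rooks_staircase RS.
- move=> R R' /set_mem /= [/full_rook_placementP[s -> sF] no].
  move=> /set_mem /= [/full_rook_placementP[s' -> sF'] no'].
  have [FS _ _] := smallest_ferrersP (rooks s).
  have [FS' _ _] := smallest_ferrersP (rooks s').
  case=> e; have eS : smallest_ferrers (rooks s) = smallest_ferrers (rooks s').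
    by rewrite -(board_of_border FS) e board_of_border.
  congr rooks; apply: (greedy_uniq (no213_greedy no)).
  by rewrite eS; apply: no213_greedy.
- move=> [D D1] /= [/= dD -> nD]; have bD := dyck_balanced dD.
  have FB := ferrers_board_of n D.
  have [s gs] := greedy_exists FB (iffLR (dyck_staircase bD) dD).
  exists (rooks s).
    split; last exact: greedy_no213 gs.
    apply/full_rook_placementP; exists s => //; have [sB _] := gs.
    by apply: fintype.subset_trans sB _; rewrite -(board_of_border FF) -never_above_board.
  by rewrite /delta (greedy_smallest FB gs) border_board_of.
Qed.

(** * The pattern 213 *)

Lemma one_line_perm213 : one_line perm213 = [:: 1; 0; 2].
Proof.
by rewrite /one_line !enum_ordSl enum_ord0 /perm213 [map _ _]/= !permE.
Qed.

Lemma standardize_213 u :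
  standardize u = [:: 1; 0; 2] <->
  exists x y z, [/\ u = [:: x; y; z], y < x & x < z].
Proof.
split=> [e | [x [y [z [-> yx xz]]]]]; last first.
  have yz := ltn_trans yx xz; rewrite /standardize /= !ltnn yx xz yz.
  by rewrite !leq_gtF // ltnW.
case: u e (congr1 size e) => [|x [|y [|z [|? ?]]]]; rewrite ?size_map // => + _.
rewrite /standardize /= !ltnn => e; exists x, y, z; split=> //.
  by case: (ltngtP x y) (ltngtP x z) (ltngtP y z) e => [] ? [] ? [] ?.
by case: (ltngtP x y) (ltngtP x z) (ltngtP y z) e => [] ? [] ? [] ?.
Qed.

Lemma subseq_map_ex (T1 T2 : eqType) (f : T1 -> T2) (u : seq T2) (s : seq T1) :
  subseq u (map f s) -> exists2 v, subseq v s & u = map f v.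
Proof.
case/subseqP => m _ ->; exists (mask m s); first exact: mask_subseq.
by rewrite map_mask.
Qed.

(** If [x < y], then [x] itself is counted on the right but not on the left. Hence standardizing
    preserves and reflects the order. *)
Lemma ltn_count_ltn (v : seq nat) x y : x \in v ->
  (count (fun z => z < x) v < count (fun z => z < y) v) = (x < y).
Proof.
have mono w a b : a <= b -> count (fun z => z < a) w <= count (fun z => z < b) w.
  by move=> ab; apply: sub_count => z /= za; apply: leq_trans ab.
move=> xv; have [xy|yx] := ltnP x y; last by rewrite ltnNge mono.
have /seq.permP e := perm_to_rem xv; rewrite !e /= ltnn xy add0n ltnS.
exact/mono/ltnW.
Qed.

Lemma word_avoids213 (v : seq nat) :
  word_avoids perm213 (standardize v) <->
  forall x y z, subseq [:: x; y; z] v -> y < x -> x < z -> False.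
Proof.
rewrite /word_avoids one_line_perm213; split=> [H x y z sub yx xz | H u sub].
  have inv a : a \in [:: x; y; z] -> a \in v by move/(mem_subseq sub).
  apply: (H _ (map_subseq _ sub)); apply/standardize_213.
  by do 3!eexists; split; [reflexivity | |]; rewrite ltn_count_ltn // inv // !inE eqxx ?orbT.
case/standardize_213 => x [y [z [eu yx xz]]].
have [[|a [|b [|c []]]] sub'] := subseq_map_ex sub; rewrite eu // => -[ex ey ez].
have inv d : d \in [:: a; b; c] -> d \in v by move/(mem_subseq sub').
apply: (H a b c sub').
  by rewrite -(ltn_count_ltn (v := v)) -?ex -?ey // inv // !inE eqxx ?orbT.
by rewrite -(ltn_count_ltn (v := v)) -?ex -?ez // inv // !inE eqxx ?orbT.
Qed.

Definition column_leq n (x y : 'I_n * 'I_n) : bool := x.1 <= y.1.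

Lemma column_leq_trans n : transitive (@column_leq n).
Proof. by move=> y x z; apply: leq_trans. Qed.

Lemma column_leq_total n : total (@column_leq n).
Proof. by move=> x y; apply: leq_total. Qed.

(** Distinct rooks have distinct columns, so sorting by column has a unique outcome, and [p] is the
    sorted list filtered by membership in [p]. *)
Lemma subseq_sorted_rooks n (s : {perm 'I_n}) (S : board n) (p : seq ('I_n * 'I_n)) :
  S \subset rooks s -> {subset p <= S} -> sorted (fun x y : 'I_n * 'I_n => x.1 < y.1) p ->
  subseq p (sort (@column_leq n) (enum S)).
Proof.
move=> /fintype.subsetP SR pS sp; set le := @column_leq n.
have up : uniq p.
  by apply: (sorted_uniq (leT := fun x y : 'I_n * 'I_n => x.1 < y.1)) => // [y x z|x];
    [apply: ltn_trans | apply: ltnn].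
have -> : p = [seq x <- sort le (enum S) | x \in p]; last exact: filter_subseq.
have lep : sorted le p by apply: sub_sorted sp => x y; apply: ltnW.
apply: (sorted_eq_in (leT := le)) lep _ _.
- by move=> x y z _ _ _; apply: column_leq_trans.
- move=> x y /pS/SR + /pS/SR; rewrite !inE => /eqP ex /eqP ey exy.
  have e1 : x.1 = y.1 by apply/val_inj/anti_leq.
  by rewrite (surjective_pairing x) (surjective_pairing y) ex ey e1.
- apply: sorted_filter; first exact: column_leq_trans.
  apply/sort_sorted/column_leq_total.
apply: uniq_perm => // [|x]; first by rewrite filter_uniq // sort_uniq enum_uniq.
by rewrite mem_filter mem_sort mem_enum; case: (boolP (x \in p)) => [/pS->|].
Qed.

Lemma rook_avoids213 n (F R : board n) : ferrers F -> full_rook_placement F R ->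
  rook_avoids F perm213 R <-> no213 R.
Proof.
move=> FF /full_rook_placementP[s -> /fintype.subsetP sF].
split=> [H [a a'] [b b'] [c c'] | H V _].
  rewrite !inE /= => /eqP-> /eqP-> /eqP-> ab bc ba ac.
  have : (c, s c) \in board_of n (border F).
    by rewrite board_of_border // sF // mem_rooks.
  case/board_ofP => t [tD /= cE cS].
  have /H/word_avoids213 : vertex n (border F) t \in vertices n (border F).
    by apply/verticesP; exists t.
  apply; last exact: ac; last exact: ba.
  set S := _ :&: _.
  have /(map_subseq (fun x => val x.2)) : subseq [:: (a, s a); (b, s b); (c, s c)]
      (sort (@column_leq n) (enum S)).
    apply: (subseq_sorted_rooks (s := s)); first exact: subsetIl.
      move=> x; rewrite !inE vertexE.
      by case/or3P=> /eqP-> /=; rewrite eqxx /=; lia.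
    by rewrite /= ab bc.
  by [].
apply/word_avoids213 => x y z sub yx xz.
have [[|p [|q [|r []]]] // sub' [ex ey ez]] := subseq_map_ex sub.
have inS d : d \in [:: p; q; r] -> d \in rooks s.
  by move/(mem_subseq sub'); rewrite mem_sort mem_enum inE => /andP[].
have pS : p \in rooks s by rewrite inS // !inE eqxx.
have qS : q \in rooks s by rewrite inS // !inE eqxx ?orbT.
have rS : r \in rooks s by rewrite inS // !inE eqxx ?orbT.
have := subseq_sorted (@column_leq_trans n) sub' (sort_sorted (@column_leq_total n) _).
rewrite /= andbT /column_leq => /andP[pq qr].
(* Sorting gives only weak inequalities between columns; they are strict because rooks in different
   rows have different columns. *)
have lt (u v : 'I_n * 'I_n) : u \in rooks s -> v \in rooks s ->
    u.1 <= v.1 -> u.2 != v.2 -> u.1 < v.1.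
  rewrite !inE => /eqP-> /eqP-> uv neq; rewrite ltn_neqAle uv andbT.
  by apply: contra neq => /eqP/val_inj->.
rewrite ex ey ez /= in yx xz.
apply: (H p q r) => //; apply: lt => //; apply/eqP => e; move: yx xz; rewrite e; lia.
Qed.

(** * Matchings *)

(* [o c] and [s r] are the indices in [border F] of its east step over column
   [c] and of its south step along row [r]. *)
Definition labelling n (F : board n) (o s : 'I_n -> 'I_(n + n)) : Prop :=
  [/\ forall c c' : 'I_n, (o c < o c') = (c < c'),
      forall r r' : 'I_n, (s r < s r') = (r' < r),
      forall c r, (o c < s r) = ((c, r) \in F),
      forall c r, o c != s r &
      forall i : 'I_(n + n), if nth east (border F) i then exists c, i = o c
                             else exists r, i = s r].

Lemma labelling_exists n (F : board n) : ferrers F -> exists o s, labelling F o s.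
Proof.
move=> FF; have bF := balanced_border FF; set D := border F in bF *.
have sD := balanced_size bF.
have tot b : steps b D (size D) = n.
  by rewrite steps_size; case/andP: bF => /eqP h1 /eqP h2; case: b.
have ex b (a : 'I_n) : exists i : 'I_(n + n), nth east D i = b /\ steps b D i = a.
  have lta : a < steps b D (size D) by rewrite tot.
  have [u [ut Du Su]] := steps_ivt (leqnn _) lta.
  by rewrite sD in ut; exists (Ordinal ut).
have [o oP] := fin_all_exists (ex east).
have [s' sP'] := fin_all_exists (ex south).
(* South steps meet the rows from top to bottom, whence the reversal. *)
pose s r := s' (rev_ord r).
have sP r : nth east D (s r) = south /\ steps south D (s r) = n - r.+1 by apply: sP'.
have lt_size (i : 'I_(n + n)) : i < size D by rewrite sD.
have stepE b (i j : 'I_(n + n)) : nth east D i = b -> nth east D j = b ->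
    (i < j) = (steps b D i < steps b D j).
  move=> Di Dj; have [ij|ji] := ltnP i j; last by apply/esym/negbTE; rewrite -leqNgt leq_steps.
  by apply/esym; apply: leq_trans (leq_steps b D ij); rewrite stepsS // Di eqxx addn1.
have uniqi b (i j : 'I_(n + n)) : nth east D i = b -> nth east D j = b ->
    steps b D i = steps b D j -> i = j.
  move=> Di Dj e; apply: val_inj.
  by case: (ltngtP i j) => //; rewrite (stepE b) // e ltnn.
exists o, s; split.
- by move=> c c'; have [[h1 h2] [h3 h4]] := (oP c, oP c'); rewrite (stepE east) // h2 h4.
- move=> r r'; have [[h1 h2] [h3 h4]] := (sP r, sP r'); rewrite (stepE south) // h2 h4.
  by have := ltn_ord r; have := ltn_ord r'; lia.
- move=> c r; have [[h1 h2] [h3 h4]] := (oP c, sP r).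
  rewrite -(board_of_border FF) -/D; apply/idP/board_ofP => [lt|[t [tD /= cE rS]]].
    (* The witness is the vertex where the south step along row [r] starts, at height [r.+1]. *)
    exists (s r); split; [exact: ltnW | | by rewrite h4 /=; have := ltn_ord r; lia].
    by apply: leq_trans (leq_steps east D lt); rewrite stepsS // h1 h2 /= addn1.
  have lt1 : o c < t.
    by rewrite ltnNge; apply/negP => /(leq_steps east D); rewrite h2; lia.
  apply: leq_trans lt1 _; rewrite leqNgt; apply/negP => /(leq_steps south D).
  by rewrite stepsS // h3 h4 /=; have := ltn_ord r; lia.
- by move=> c r; apply/eqP => e; have [[+ _] [+ _]] := (oP c, sP r); rewrite e => ->.
move=> i; have lti b : nth east D i = b -> steps b D i < n.
  move=> Di; have := leq_steps b D (lt_size i).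
  by rewrite tot stepsS // Di eqxx addn1.
case Di : (nth _ _ _).
  exists (Ordinal (lti east Di)); have [h1 h2] := oP (Ordinal (lti east Di)).
  by apply: (uniqi east).
exists (rev_ord (Ordinal (lti south Di))).
have [h1 h2] := sP' (Ordinal (lti south Di)).
by rewrite /s rev_ordK; apply: (uniqi south).
Qed.

Section Labelling.

Variables (n : nat) (F : board n) (o s : 'I_n -> 'I_(n + n)).
Hypothesis os : labelling F o s.

Definition rooks_of_matching (M : edges n) : board n :=
  [set x | [set o x.1; s x.2] \in M].

Definition matching_of_rooks (R : board n) : edges n :=
  [set [set o x.1; s x.2] | x in R].

Let o_inj : injective o.
Proof.
have [o_mono _ _ _ _] := os; move=> c c' e; apply: val_inj.
by case: (ltngtP c c') => //; rewrite -o_mono e ltnn.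
Qed.

Let s_inj : injective s.
Proof.
have [_ s_mono _ _ _] := os; move=> r r' e; apply: val_inj.
by case: (ltngtP r r') => //; rewrite -s_mono e ltnn.
Qed.

Let os_neq c r : o c != s r. Proof. by have [] := os. Qed.

Lemma edge_inj (x y : 'I_n * 'I_n) : [set o x.1; s x.2] = [set o y.1; s y.2] -> x = y.
Proof.
move=> e; have : o x.1 \in [set o y.1; s y.2] by rewrite -e !inE eqxx.
have : s x.2 \in [set o y.1; s y.2] by rewrite -e !inE eqxx orbT.
rewrite !inE (negbTE (os_neq _ _)) [s _ == _]eq_sym (negbTE (os_neq _ _)) /= orbF.
move=> /eqP/s_inj e2 /eqP/o_inj e1.
by rewrite (surjective_pairing x) e1 e2 -surjective_pairing.
Qed.

Lemma mem_matching_of_rooks R (x : 'I_n * 'I_n) :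
  ([set o x.1; s x.2] \in matching_of_rooks R) = (x \in R).
Proof.
apply/imsetP/idP => [[y yR /edge_inj->] // | xR]; by exists x.
Qed.

Lemma rooks_of_matchingK R : rooks_of_matching (matching_of_rooks R) = R.
Proof. by apply/setP => x; rewrite inE mem_matching_of_rooks. Qed.

Lemma opener_nth (M : edges n) : matching_path M = border F ->
  forall i, opener M i = nth east (border F) i.
Proof.
move=> <- i; rewrite (nth_map i) ?size_enum_ord // nth_ord_enum.
by case: opener.
Qed.

Lemma nth_border_o c : nth east (border F) (o c) = east.
Proof.
have [_ _ _ _ cov] := os; have := cov (o c).
by case: nth => // -[r e]; have := os_neq c r; rewrite e eqxx.
Qed.

Lemma nth_border_s r : nth east (border F) (s r) = south.
Proof.
have [_ _ _ _ cov] := os; have := cov (s r).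
by case: nth => // -[c e]; have := os_neq c r; rewrite e eqxx.
Qed.

(** The smaller end [i] is an opener. Were [j] one too, with partner [k], the blocks of [j] would
    coincide and [i] would be [j] or [k], although i < j < k. *)
Lemma matching_edge (M : edges n) (i j : 'I_(n + n)) : perfect_matching M ->
  matching_path M = border F -> i < j -> [set i; j] \in M ->
  exists c r, [/\ i = o c, j = s r & [set o c; s r] \in M].
Proof.
move=> [/and3P[_ /finset.trivIsetP tr _] _] eP ij ijM; have op := opener_nth eP.
have [_ _ _ _ cov] := os.
have opi : opener M i by apply/existsP; exists j; rewrite ij.
have opj : ~~ opener M j.
  apply/existsP => -[k /andP[jk jkM]].
  have eB : [set i; j] = [set j; k].
    apply/eqP; apply: contraT => /(tr _ _ ijM jkM)/pred0P/(_ j).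
    by rewrite /= !inE eqxx ?orbT.
  have : i \in [set j; k] by rewrite -eB !inE eqxx.
  by rewrite !inE => /orP[]/eqP e; move: ij jk; rewrite e; lia.
have := cov i; have := cov j; rewrite -!op opi (negbTE opj) => -[r er] [c ec].
by exists c, r; rewrite -ec -er.
Qed.

Lemma matching_block (M : edges n) B : perfect_matching M ->
  matching_path M = border F -> B \in M ->
  exists2 x : 'I_n * 'I_n, B = [set o x.1; s x.2] & x \in rooks_of_matching M.
Proof.
move=> pM eP BM; have [_ M2] := pM.
have /eqP/cards2P[i [j [ij eB]]] := M2 B BM.
wlog lt : i j ij eB / i < j => [wl|].
  have [/(wl i j)|/(wl j i)|/val_inj e] := ltngtP i j; first exact.
    by rewrite eq_sym finset.setUC; apply.
  by rewrite e eqxx in ij.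
move: BM; rewrite eB => ijM.
have [c [r [-> -> crM]]] := matching_edge pM eP lt ijM.
by exists (c, r); rewrite ?inE.
Qed.

Lemma rooks_of_matching_placement (M : edges n) : perfect_matching M ->
  matching_path M = border F -> full_rook_placement F (rooks_of_matching M).
Proof.
move=> pM eP; have op := opener_nth eP; have [o_mono s_mono osF _ cov] := os.
have [/and3P[/eqP covM /finset.trivIsetP tr _] _] := pM.
(* In the other order [s r] would be an opener, whereas the border goes south there. *)
have oM c r : [set o c; s r] \in M -> o c < s r.
  move=> crM; rewrite ltn_neqAle os_neq /= leqNgt; apply/negP => lt.
  have : opener M (s r) by apply/existsP; exists (o c); rewrite lt /= finset.setUC.
  by rewrite op nth_border_s.
split.
- apply/fintype.subsetP => -[c r]; rewrite inE /= -osF; exact: oM.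
- move=> c; have : opener M (o c) by rewrite op nth_border_o.
  case/existsP => j /andP[lt cjM].
  have [c' [r [/o_inj ec _ crM]]] := matching_edge pM eP lt cjM.
  apply/eqP/cards1P; exists (c, r); apply/setP => -[a b]; rewrite !inE /= xpair_eqE.
  case: eqP => [->|]; rewrite ?andbF //= andbT; apply/idP/eqP => [cbM|->]; last by rewrite ec.
  have eB : [set o c; s b] = [set o c'; s r].
    apply/eqP; apply: contraT => /(tr _ _ cbM crM)/pred0P/(_ (o c)).
    by rewrite /= !inE ec eqxx.
  by have [_ ->] := @edge_inj (c, b) (c', r) eB.
move=> r; have : s r \in finset.cover M by rewrite covM inE.
case/finset.bigcupP => _ /(matching_block pM eP)[[c r'] -> /=].
rewrite inE /= => cr'M; rewrite !inE eq_sym (negbTE (os_neq _ _)) => /eqP/s_inj rr'.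
subst r'; apply/eqP/cards1P; exists (c, r); apply/setP => -[a b]; rewrite !inE /= xpair_eqE.
rewrite andbC; case: (b =P r) => [->|]; rewrite ?andbF //= andbT.
apply/idP/eqP => [arM|->//].
have eB' : [set o a; s r] = [set o c; s r].
  apply/eqP; apply: contraT => /(tr _ _ arM cr'M)/pred0P/(_ (s r)).
  by rewrite /= !inE eqxx !orbT.
by have [->] := @edge_inj (a, r) (c, r) eB'.
Qed.

Lemma matching_of_rooksK (M : edges n) : perfect_matching M ->
  matching_path M = border F -> matching_of_rooks (rooks_of_matching M) = M.
Proof.
move=> pM eP; apply/setP => B; apply/imsetP/idP => [[x] | BM].
  by rewrite inE => xM ->.
by have [x -> xM] := matching_block pM eP BM; exists x.
Qed.

Lemma matching_of_rooks_perfect (R : board n) :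
  ferrers F -> full_rook_placement F R ->
  perfect_matching (matching_of_rooks R) /\
  matching_path (matching_of_rooks R) = border F.
Proof.
move=> FF /full_rook_placementP[t eR /fintype.subsetP RF].
have [o_mono s_mono osF _ cov] := os.
have inR c r : ((c, r) \in R) = (r == t c) by rewrite eR inE.
have sD := balanced_size (balanced_border FF).
split; first split.
- apply/and3P; split.
  + apply/eqP/setP => i; rewrite inE; apply/finset.bigcupP.
    have [c [r [cr ei]]] : exists c r, (c, r) \in R /\ (i = o c \/ i = s r).
      have := cov i; case: nth => -[a ->].
        by exists a, (t a); rewrite inR eqxx; split=> //; left.
      by exists ((t^-1)%g a), a; rewrite inR permKV; split=> //; right.
    exists [set o c; s r]; first by rewrite (mem_matching_of_rooks R (c, r)).
    by case: ei => ->; rewrite !inE eqxx ?orbT.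
  + apply/finset.trivIsetP => B B' /imsetP[[c r] crR ->] /imsetP[[c' r'] crR' ->] /= neq.
    rewrite finset.disjoints_subset; apply/fintype.subsetP => x; rewrite !inE.
    move: crR crR' neq; rewrite !inR => /eqP-> /eqP-> neq.
    have cc : c != c' by apply: contra neq => /eqP->.
    case/orP => /eqP ->; rewrite negb_or ?(inj_eq o_inj) ?(inj_eq s_inj) ?(inj_eq perm_inj) cc.
      by rewrite os_neq.
    by rewrite eq_sym os_neq.
  + apply/imsetP => -[[c r] _ /= e]; have : o c \in finset.set0 by rewrite e !inE eqxx.
    by rewrite inE.
- by move=> B /imsetP[[c r] _ ->]; rewrite cards2 os_neq.
apply: (eq_from_nth (x0 := east)); rewrite /matching_path size_map size_enum_ord ?sD //.
move=> k kn; rewrite (nth_map (Ordinal kn)) ?size_enum_ord //.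
rewrite -[k]/(val (Ordinal kn)) nth_ord_enum; set i := Ordinal kn.
have := cov i; case: nth => -[a ->].
  suff -> : opener (matching_of_rooks R) (o a) by [].
  have aR : (a, t a) \in R by rewrite inR.
  apply/existsP; exists (s (t a)); rewrite osF RF //=.
  by rewrite (mem_matching_of_rooks R (a, t a)).
(* The partner of [s a] is some [o c] with ([c], [a]) in [F], so it comes before [s a], which is
   therefore not an opener. *)
case: ifPn => // /existsP[j /andP[lt /imsetP[[c r] crR /= e]]].
have : s a \in [set o c; s r] by rewrite -e !inE eqxx.
rewrite !inE eq_sym (negbTE (os_neq _ _)) /= => /eqP/s_inj ea.
have : o c \in [set s a; j] by rewrite e !inE eqxx.
rewrite !inE (negbTE (os_neq _ _)) /= => /eqP ej.
by have := RF _ crR; rewrite -osF -ea ej; move: lt; lia.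
Qed.

Lemma matching_avoids213 (M : edges n) : perfect_matching M ->
  matching_path M = border F ->
  matching_avoids perm213 M <-> no213 (rooks_of_matching M).
Proof.
move=> pM eP; have [o_mono s_mono osF _ cov] := os.
have /full_rook_placementP[t eR RF] := rooks_of_matching_placement pM eP.
have t0 : perm213 ord0 = Ordinal (isT : 1 < 3) by rewrite permE /=; apply: val_inj.
have t1 : perm213 (Ordinal (isT : 1 < 3)) = ord0 by rewrite permE /=; apply: val_inj.
have t2 : perm213 ord_max = ord_max by rewrite permE /=; apply: val_inj.
split=> [H [c1 r1] [c2 r2] [c3 r3] | H [i i_mono iM]].
  rewrite !inE /= => M1 M2 M3 lt1 lt2 lt3 lt4; apply: H.
  (* Closers appear by decreasing row, and r2 < r1 < r3. The square ([c3], [r3]) of [F] puts the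
     last opener before the first closer. Positions 0, 1, 2 are thus paired with 4, 5, 3, that is,
     [a] with 5 - tau(a). *)
  pose l := [:: o c1; o c2; o c3; s r3; s r1; s r2].
  have F3 : o c3 < s r3 by rewrite osF; apply: (fintype.subsetP RF); rewrite inE.
  exists (fun k : 'I_(3 + 3) => nth (o c1) l k).
    have sl : sorted (fun x y : 'I_(n + n) => x < y) l.
      by rewrite /= !o_mono !s_mono F3 lt1 lt2 lt3 lt4.
    move=> x y xy; apply: (sorted_ltn_nth _ _ sl) => //; first by move=> ? ? ?; apply: ltn_trans.
      exact: (ltn_ord x).
    exact: (ltn_ord y).
  move=> [[|[|[|//]]] lta].
  - by rewrite (_ : Ordinal lta = ord0) ?t0 //; apply: val_inj.
  - by rewrite (_ : Ordinal lta = Ordinal (isT : 1 < 3)) ?t1 //; apply: val_inj.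
  - by rewrite (_ : Ordinal lta = ord_max) ?t2 //; apply: val_inj.
have := iM ord_max; have := iM (Ordinal (isT : 1 < 3)); have := iM ord0.
rewrite t0 t1 t2 => M1 M2 M3.
have [|c1 [r1 [e1 f1 M1']]] := matching_edge pM eP _ M1; first exact: i_mono.
have [|c2 [r2 [e2 f2 M2']]] := matching_edge pM eP _ M2; first exact: i_mono.
have [|c3 [r3 [e3 f3 M3']]] := matching_edge pM eP _ M3; first exact: i_mono.
apply: (H (c1, r1) (c2, r2) (c3, r3)); rewrite ?inE //=.
- by rewrite -o_mono -e1 -e2; apply: i_mono.
- by rewrite -o_mono -e2 -e3; apply: i_mono.
- by rewrite -s_mono -f1 -f2; apply: i_mono.
- by rewrite -s_mono -f1 -f3; apply: i_mono.
Qed.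

End Labelling.

Theorem theorem3p5 (n : nat) (F : board n) (HF : ferrers_dyck F) :
  set_bij (avoiding_rooks F perm213) (dyck_pairs F) (delta F) /\
  exists f : edges n -> lpath * lpath,
    set_bij (avoiding_matchings F perm213) (dyck_pairs F) f.
Proof.
have /andP[FF _] := HF.
have eqR : avoiding_rooks F perm213 =
    [set R | full_rook_placement F R /\ no213 R]%classic.
  by apply/seteqP; split=> R /= [fR aR]; split=> //; apply/(rook_avoids213 FF fR).
have bij := delta_bij HF; rewrite eqR; split=> //.
have [o [s os]] := labelling_exists FF.
exists (delta F \o rooks_of_matching o s); apply: set_bij_comp bij.
split.
- move=> M /= [pM eP aM]; split; first exact (rooks_of_matching_placement os pM eP).
  exact/(matching_avoids213 os pM eP).
- move=> M M' /set_mem /= [pM eP _] /set_mem /= [pM' eP' _] e.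
  by rewrite -(matching_of_rooksK os pM eP) e (matching_of_rooksK os pM' eP').
move=> R /= [fR nR]; have [pM eP] := matching_of_rooks_perfect os FF fR.
exists (matching_of_rooks o s R); last exact: rooks_of_matchingK os R.
by split=> //; apply/(matching_avoids213 os pM eP); rewrite (rooks_of_matchingK os).
Qed.
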